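(* The triple $(\mathcal{R}(K_2,\Sigma_2),\le,r)$ is a topological Ramsey space, and $\mathcal{R}(K_2,\Sigma_2)$ is dense in the partial ordering $(\mathrm{PC}_{\infty}(K_2,\Sigma_2),\le)$ of all pure candidates, i.e. for every $\bar t\in \mathrm{PC}_{\infty}(K_2,\Sigma_2)$ there is $\bar s\in\mathcal{R}(K_2,\Sigma_2)$ with $\bar s\le\bar t$.
   Context: Natural numbers are identified with the sets of their predecessors; $\omega=\{0,1,2,\dots\}$. FP creatures. Let $\mathbf H$ be a function on $\omega$ with each $\mathbf H(i)$ a finite non-empty set. $\mathcal F_{\mathbf H}$ is the set of all finite non-empty functions $f$ with $\mathrm{dom}(f)\subseteq\omega$ and $f(i)\in\mathbf H(i)$ for all $i\in\mathrm{dom}(f)$. An FP creature for $\mathbf H$ is a tuple $t=(\mathbf{nor}[t],\mathbf{val}[t],\mathbf{dis}[t],m^t_{\mathrm{dn}},m^t_{\mathrm{up}})$ where $\mathbf{nor}[t]$ is a non-negative real, $\mathbf{dis}[t]$ is an arbitrary object, $m^t_{\mathrm{dn}}<m^t_{\mathrm{up}}<\omega$, and $\mathbf{val}[t]$ is a non-empty finite subset of $\mathcal F_{\mathbf H}$ with $\mathrm{dom}(f)\subseteq[m^t_{\mathrm{dn}},m^t_{\mathrm{up}})$ for all $f\in\mathbf{val}[t]$. The pair $(K_2,\Sigma_2)$. Let $\mathbf H_2(n)=2$ for $n<\omega$. $K_2$ consists of all FP creatures $t$ for $\mathbf H_2$ such that: $\emptyset\ne\mathbf{dis}[t]\subseteq[m^t_{\mathrm{dn}},m^t_{\mathrm{up}})$;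 $\emptyset\ne\mathbf{val}[t]\subseteq{}^{\mathbf{dis}[t]}2$ (functions from $\mathbf{dis}[t]$ to $\{0,1\}$); and $\mathbf{nor}[t]=\log_2(|\mathbf{val}[t]|)$. For $t_0,\dots,t_n\in K_2$ with $m^{t_l}_{\mathrm{up}}\le m^{t_{l+1}}_{\mathrm{dn}}$ for all $l<n$, $\Sigma_2(t_0,\dots,t_n)$ consists of all $t\in K_2$ such that $m^t_{\mathrm{dn}}=m^{t_0}_{\mathrm{dn}}$, $m^t_{\mathrm{up}}=m^{t_n}_{\mathrm{up}}$, and for some $l^*\le n$, $\mathbf{dis}[t]=\mathbf{dis}[t_{l^*}]$ and $\mathbf{val}[t]\subseteq\mathbf{val}[t_{l^*}]$. Pure candidates. $\mathrm{PC}_{\infty}(K_2,\Sigma_2)$ is the set of all infinite sequences $\bar t=(t_0,t_1,\dots)$ of members of $K_2$ such that $m^{t_n}_{\mathrm{up}}\le m^{t_{n+1}}_{\mathrm{dn}}$ for all $n$ and $\lim_{n\to\infty}\mathbf{nor}[t_n]=\infty$. It is ordered by: $\bar t\le\bar s$ iff there is a sequence $(u_n)_{n<\omega}$ of non-empty finite subsets of $\omega$ such that $\max(u_n)<\min(u_{n+1})$ and $t_n\in\Sigma_2(\bar s\restriction u_n)$ for each $n$, where $\bar s\restriction u_n$ is the sequence $(s_i:i\in u_n)$ in increasing order of indices. The space. $\mathcal{R}(K_2,\Sigma_2)=\{\bar t\in\mathrm{PC}_{\infty}(K_2,\Sigma_2):\forall l<\omega,\ |\mathbf{val}[t_l]|=l+1\}$,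 with the inherited order $\le$ and the restriction maps $r_k(\bar t)=(t_i:i<k)$, $k<\omega$. Topological Ramsey spaces. For a set $\mathcal R$ of infinite sequences $\bar t=(t_0,t_1,\dots)$ with quasi-order $\le$ and restriction maps $r_k(\bar t)=(t_i:i<k)$, $k<\omega$, let $\mathcal{AR}=\{r_k(\bar t):k<\omega,\ \bar t\in\mathcal R\}$, and for $a\in\mathcal{AR}$, $\bar t\in\mathcal R$ let $[a,\bar t\,]=\{\bar s\in\mathcal R:\bar s\le\bar t\text{ and }r_k(\bar s)=a\text{ for some }k<\omega\}$. The Ellentuck topology on $\mathcal R$ is generated by the sets $[a,\bar t\,]$ as basic open sets. Nowhere dense and meager are taken with respect to this topology, and $\mathcal X\subseteq\mathcal R$ has the property of Baire if $\mathcal X=\mathcal O\,\triangle\,\mathcal M$ with $\mathcal O$ Ellentuck open and $\mathcal M$ Ellentuck meager. $\mathcal X\subseteq\mathcal R$ is Ramsey if for every non-empty $[a,\bar t\,]$ there is $\bar s\in[a,\bar t\,]$ with $[a,\bar s\,]\subseteq\mathcal X$ or $[a,\bar s\,]\cap\mathcal X=\emptyset$; it is Ramsey null if for every non-empty $[a,\bar t\,]$ there is $\bar s\in[a,\bar t\,]$ with $[a,\bar s\,]\cap\mathcal X=\emptyset$. $(\mathcal R,\le,r)$ is a topological Ramsey space if every subset of $\mathcal R$ with the property of Baire is Ramsey and every meager subset of $\mathcal R$ is Ramsey null. *)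

(* Defs.v *)
(* MathComp + MathComp-Analysis *)
From HB Require Import structures.
From mathcomp Require Import all_boot all_order all_algebra.
From mathcomp Require Import finmap.
From mathcomp Require Import all_classical all_reals all_analysis.

Set Implicit Arguments.
Unset Strict Implicit.
Unset Printing Implicit Defensive.

Import Order.TTheory GRing.Theory Num.Theory.

Local Open Scope classical_set_scope.

(** * Ramsey spaces of infinite sequences *)

Definition restr (T : Type) (k : nat) (t : nat -> T) : seq T := mkseq t k.

(* The set [X] of sequences as a type; the phantom argument [le] makes it
   possible to attach the topology, which depends on the quasi-order. *)
Definition ellentuck (T : Type) (X : set (nat -> T))
  (le : (nat -> T) -> (nat -> T) -> Prop) : Type := set_type X.

Section Ramsey.
Variables (T : Type) (X : set (nat -> T)).
Variable le : (nat -> T) -> (nat -> T) -> Prop.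
Local Notation S := (ellentuck X le).

Definition seq_of (t : S) : nat -> T := sval t.

Definition AR : set (seq T) := [set a | exists k (t : S), a = restr k (seq_of t)].

Definition basic (a : seq T) (t : S) : set S :=
  [set s | le (seq_of s) (seq_of t) /\ exists k, restr k (seq_of s) = a].

Definition basics : set (set S) :=
  [set B | exists a t, AR a /\ B = basic a t].

HB.instance Definition _ := gen_eqMixin S.
HB.instance Definition _ := gen_choiceMixin S.

(* [basics] is only used as a subbase here; for a quasi-order it is a base of the
   resulting topology, see [open_ellentuckE]. *)
HB.instance Definition _ := isSubBaseTopological.Build S basics id.

Definition nowhere_dense (A : set S) : Prop := (closure A)^° = set0.

Definition meager (A : set S) : Prop :=
  exists2 F : nat -> set S, (forall n, nowhere_dense (F n)) & A = \bigcup_n F n.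

Definition has_Baire_property (A : set S) : Prop :=
  exists O M : set S, [/\ open O, meager M & A = O `+` M].

Definition Ramsey (A : set S) : Prop :=
  forall a t, AR a -> basic a t !=set0 ->
  exists2 s, basic a t s &
    basic a s `<=` A \/ basic a s `&` A = set0.

Definition Ramsey_null (A : set S) : Prop :=
  forall a t, AR a -> basic a t !=set0 ->
  exists2 s, basic a t s & basic a s `&` A = set0.

Definition topological_Ramsey_space : Prop :=
  [/\ forall t, X t -> le t t,
      forall t s u, X t -> X s -> X u -> le t s -> le s u -> le t u,
      forall A : set S, has_Baire_property A -> Ramsey A &
      forall A : set S, meager A -> Ramsey_null A].

End Ramsey.

Lemma restr_take T k m (t : nat -> T) : (k <= m)%N -> restr k t = take k (restr m t).
Proof. by move=> km; rewrite /restr /mkseq -map_take take_iota (minn_idPl km). Qed.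

Lemma open_ellentuckE T (X : set (nat -> T)) le
  (rf : forall t, X t -> le t t)
  (tr : forall t s u, X t -> X s -> X u -> le t s -> le s u -> le t u)
  (A : set (ellentuck X le)) :
  open A <-> forall s, A s -> exists a t, [/\ AR X le a, basic a t s & basic a t `<=` A].
Proof.
have Xs (s : ellentuck X le) : X (seq_of s) by case: s => s /=; rewrite inE.
split.
  move=> [D' sD <-] s [B DB]; have [E sE EB] := sD _ DB; move: DB; rewrite -EB => DB EsB.
  have key : forall l : seq (set (ellentuck X le)), (forall B, B \in l -> basics B /\ B s) ->
    exists k, forall B, B \in l -> basic (restr k (seq_of s)) s `<=` B.
    elim=> [|C l IH] H; first by exists 0%N.
    have [k Hk] := IH (fun B Bl => H B (mem_behead (s := C :: l) Bl)).
    have [[a [t [_ CE]]] Cs] := H C (mem_head _ _).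
    subst C; case: Cs => lst [m rm].
    exists (maxn k m) => B0; rewrite inE => /orP[/eqP->|B0l].
      move=> x [lx [j rj]]; split; first by apply: tr lx lst.
      exists m; rewrite -rm.
      have jE : j = maxn k m by move: (congr1 size rj); rewrite !size_mkseq.
      by rewrite jE in rj; rewrite (@restr_take _ _ _ _ (leq_maxr k m)) rj -(@restr_take _ _ (maxn k m)) // leq_maxr.
    apply: subset_trans (Hk _ B0l) => x [lx [j rj]]; split=> //.
    exists k.
    have jE : j = maxn k m by move: (congr1 size rj); rewrite !size_mkseq.
    by rewrite jE in rj; rewrite (@restr_take _ _ _ _ (leq_maxl k m)) rj -(@restr_take _ _ (maxn k m)) // leq_maxl.
  have [|k Hk] := key (enum_fset E).
    move=> B0 B0E; split; last exact: EsB.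
    by have := sE _ B0E; rewrite inE.
  exists (restr k (seq_of s)), s; split; first by exists k, s.
    by split; [exact: rf (Xs _)|exists k].
  move=> x Hx; exists (\bigcap_(i in [set` E]) id i); last by move=> B0 /= B0E; exact: (Hk _ B0E).
  exact: DB.
move=> H.
have -> : A = \bigcup_(B in [set B | basics B /\ B `<=` A]) B.
  apply/seteqP; split=> [s /H [a [t [aR bs bA]]]|s [B [_ BA]] /BA//].
  by exists (basic a t) => //; split=> //; exists a, t.
apply: bigcup_open => B [bB _].
exists [set B]; last by rewrite bigcup_set1.
move=> _ ->; exists [fset B]%fset; first by move=> C /= /fset1P ->; rewrite inE; exact: bB.
by rewrite set_fset1 bigcap_set1.
Qed.

(** * FP creatures *)

(* Finite partial functions on the naturals are finite maps [{fmap nat -> V}];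
   [D] is the type of the objects [dis t]. *)
Record creature (R : realType) (V : choiceType) (D : Type) := Creature {
  nor : R;
  vals : {fset {fmap nat -> V}};
  dis : D;
  mdn : nat;
  mup : nat }.

Section FP.
Variables (R : realType) (V : choiceType) (D : Type) (H : nat -> {fset V}).
Local Notation creature := (creature R V D).

Definition FH : set {fmap nat -> V} :=
  [set f | domf f != fset0 /\ forall i (fi : i \in domf f), f.[fi]%fmap \in H i].

Definition FP_creature : set creature :=
  [set t | [/\ (0 <= nor t)%R, (mdn t < mup t)%N, vals t != fset0 &
    forall f, f \in vals t ->
      FH f /\ forall i, i \in domf f -> (mdn t <= i < mup t)%N]].

End FP.

(** * Pure candidates *)

Section PureCandidates.
Variables (R : realType) (V : choiceType) (D : Type).
Local Notation creature := (creature R V D).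
Variables (K : set creature) (Sigma : seq creature -> set creature).

Definition PC_infty : set (nat -> creature) :=
  [set t | [/\ forall n, K (t n),
               forall n, (mup (t n) <= mdn (t n.+1))%N &
               nor (t n) @[n --> \oo] --> +oo%R]].

Definition restr_set (s : nat -> creature) (u : {fset nat}) : seq creature :=
  [seq s i | i <- sort leq u].

(* For non-empty [u n] and [u n.+1], the condition on elements is
   max (u n) < min (u n.+1). *)
Definition pc_le (t s : nat -> creature) : Prop :=
  exists u : nat -> {fset nat},
    [/\ forall n, u n != fset0,
        forall n i j, i \in u n -> j \in u n.+1 -> (i < j)%N &
        forall n, Sigma (restr_set s (u n)) (t n)].

End PureCandidates.

(** * The pair (K_2, Sigma_2) *)

Section K2.
Variable R : realType.

Definition H2 (n : nat) : {fset nat} := [fset 0%N; 1%N]%fset.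

Definition creature2 : Type := creature R nat {fset nat}.

Definition K2 : set creature2 :=
  [set t | [/\ FP_creature H2 t,
    dis t != fset0 /\ (forall i, i \in dis t -> (mdn t <= i < mup t)%N),
    vals t != fset0 /\ (forall f, f \in vals t -> domf f = dis t) &
    nor t = (ln (#|` vals t|%:R) / ln 2)%R]].

Definition Sigma2_dom (ts : seq creature2) : Prop :=
  (forall l d, (l < size ts)%N -> K2 (nth d ts l)) /\
  (forall l d, (l.+1 < size ts)%N ->
     (mup (nth d ts l) <= mdn (nth d ts l.+1))%N).

(* Defined on non-empty sequences satisfying [Sigma2_dom], empty elsewhere. *)
Definition Sigma2 (ts : seq creature2) : set creature2 :=
  if ts is t0 :: ts' then
    [set t | [/\ Sigma2_dom ts, K2 t, mdn t = mdn t0, mup t = mup (last t0 ts') &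
      exists l, [/\ (l < size ts)%N, dis t = dis (nth t0 ts l) &
                    (vals t `<=` vals (nth t0 ts l))%fset]]]
  else set0.

Definition PC2 : set (nat -> creature2) := PC_infty K2.

Definition PC2_le : (nat -> creature2) -> (nat -> creature2) -> Prop :=
  pc_le Sigma2.

Definition R2 : set (nat -> creature2) :=
  [set t | PC2 t /\ forall l, #|` vals (t l)| = l.+1].

End K2.

(* Main.v *)
(** For blocked sequences, [s <= t] means that every [s n] lies in the set [gen t]
of creatures generated by [t]; so a basic set is determined by a stem [a] and a
set of admissible creatures, and [t] may be any sequence with unbounded norms.
Ellentuck's argument then runs as usual: properties [P a t] which are hereditary
and dense in [t] can be made to hold for all stems at once by fusion; combinatorial
forcing with a pigeonhole principle for one-step extensions decides open sets;
nowhere dense and meager sets are avoided by one more fusion.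

Pigeonhole: a creature generated by [t] is given by indices [i <= l <= j] and a
subset [A] of [vals (t l)]. Take a nonprincipal ultrafilter [U] on the indices and
an ultrafilter [V] of sets of pairs [(l, A)] each of which contains all
[p]-subsets of arbitrarily large sets; [V] exists by the finite Ramsey theorem.
The colour of the iterated limit along [U], [V], [U] is made constant by choosing
the [i], [(l, B)], [j] of the new creatures one after the other. *)

From HB Require Import structures.
From mathcomp Require Import all_boot all_order all_algebra.
From mathcomp Require Import finmap.
From mathcomp Require Import all_classical all_reals all_analysis.
From mathcomp Require Import zify.
(* Last, since [mup] is also the multiplicity of a root in MathComp. *)
Require Import Defs.

Set Implicit Arguments.
Unset Strict Implicit.
Unset Printing Implicit Defensive.

Import Order.TTheory GRing.Theory Num.Theory.

Local Open Scope classical_set_scope.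

(** * The finite Ramsey theorem *)

(** Dependent choice along an invariant. Outside [I] the step returns [x] itself; this makes it
    total, so that plain choice gives a function to iterate. *)
Lemma dep_choice T (I : T -> Prop) (S : T -> T -> Prop) (x0 : T) :
  I x0 -> (forall x, I x -> exists2 y, I y & S x y) ->
  exists f : nat -> T, f 0%N = x0 /\ forall n, I (f n) /\ S (f n) (f n.+1).
Proof.
move=> I0 step.
have /choice [g gP] : forall x, exists y, I x -> I y /\ S x y.
  move=> x; have [/step[y Iy Sxy]|nI] := pselect (I x); first by exists y.
  by exists x.
have If n : I (iter n g x0) by elim: n => //= n /gP[].
exists (fun n => iter n g x0); split=> // n; split=> //.
exact: (gP _ (If n)).2.
Qed.

Section FiniteRamsey.
Local Open Scope fset_scope.
Variable K : choiceType.

Lemma exists_fsubset (S : {fset K}) n : (n <= #|` S|)%N ->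
  exists2 A, A `<=` S & #|` A| = n.
Proof.
move=> nS; exists [fset x in take n (enum_fset S)].
  by apply/fsubsetP => x; rewrite !inE => /mem_take.
rewrite card_fseq undup_id ?size_takel //.
by rewrite take_uniq.
Qed.

(** Remove a point [x], colour each [p]-set of the rest by the colour it gets when [x] is added, and
    continue inside a set homogeneous for this colouring. Separate targets [n1] and [n2] let the
    inner induction lower one of them at a time. *)
Lemma hypergraph_Ramsey p n1 n2 : exists N, forall (S : {fset K}) (Q : {fset K} -> Prop),
  (N <= #|` S|)%N ->
  (exists T, [/\ T `<=` S, (n1 <= #|` T|)%N & forall A, A `<=` T -> #|` A| = p -> Q A]) \/
  (exists T, [/\ T `<=` S, (n2 <= #|` T|)%N & forall A, A `<=` T -> #|` A| = p -> ~ Q A]).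
Proof.
elim: p n1 n2 => [n1 n2|p IHp n1 n2].
  exists (maxn n1 n2) => S Q; rewrite geq_max => /andP[S1 S2].
  have [Q0|Q0] := pselect (Q fset0); [left|right];
    by exists S; split=> // A _ /cardfs0_eq ->.
(* If a target is 0, the empty set serves: it has no subset with [p.+1] elements. *)
have [m] := ubnP (n1 + n2); elim: m n1 n2 => // m IHm [|n1] [|n2] nm.
- exists 0%N => S Q _; left; exists fset0; split=> // A.
  by rewrite fsubset0 => /eqP ->; rewrite cardfs0.
- exists 0%N => S Q _; left; exists fset0; split=> // A.
  by rewrite fsubset0 => /eqP ->; rewrite cardfs0.
- exists 0%N => S Q _; right; exists fset0; split=> // A.
  by rewrite fsubset0 => /eqP ->; rewrite cardfs0.
have lt1 : (n1 + n2.+1 < m)%N by lia.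
have lt2 : (n1.+1 + n2 < m)%N by lia.
have [M1 M1P] := IHm _ _ lt1.
have [M2 M2P] := IHm _ _ lt2.
have [M MP] := IHp M1 M2.
exists M.+1 => S Q MS.
have [x xS] : exists x, x \in S by apply/fset0Pn; rewrite -cardfs_gt0; apply: leq_trans MS.
have MSx : (M <= #|` S `\ x|)%N by rewrite (cardfsD1 x) xS in MS; lia.
have sub_split T A : A `<=` x |` T -> #|` A| = p.+1 ->
    A `<=` T \/ exists2 B, B `<=` T /\ #|` B| = p & A = x |` B.
  move=> AT Ap; case: (boolP (x \in A)) => xA.
    right; exists (A `\ x); last by rewrite fsetD1K.
    by split; [rewrite fsubDset|rewrite (cardfsD1 x) xA in Ap; case: Ap].
  left; apply/fsubsetP => y yA; have := fsubsetP AT y yA; rewrite !inE => /orP[/eqP yx|//].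
  by rewrite -yx yA in xA.
have subS T : T `<=` S `\ x -> T `<=` S /\ x \notin T.
  rewrite fsubsetD1 => /andP[-> ->] //.
have [[T [TS T1 TQ]]|[T [TS T1 TQ]]] := MP _ (fun A => Q (x |` A)) MSx.
- have [[W [WT W1 WQ]]|[W [WT W1 WQ]]] := M1P T Q T1; last first.
    right; exists W; split=> //; apply: fsubset_trans WT _; exact: (subS _ TS).1.
  have [WS xW] := subS _ (fsubset_trans WT TS).
  left; exists (x |` W); split; first by rewrite fsubUset fsub1set xS.
    by rewrite cardfsU1 xW; lia.
  move=> A AW Ap; have [|[B [BW Bp] ->]] := sub_split _ _ AW Ap; first by move=> /WQ; apply.
  by apply: TQ => //; apply: fsubset_trans WT.
- have [[W [WT W1 WQ]]|[W [WT W1 WQ]]] := M2P T Q T1.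
    left; exists W; split=> //; apply: fsubset_trans WT _; exact: (subS _ TS).1.
  have [WS xW] := subS _ (fsubset_trans WT TS).
  right; exists (x |` W); split; first by rewrite fsubUset fsub1set xS.
    by rewrite cardfsU1 xW; lia.
  move=> A AW Ap; have [|[B [BW Bp] ->]] := sub_split _ _ AW Ap; first by move=> /WQ; apply.
  by apply: TQ => //; apply: fsubset_trans WT.
Qed.

End FiniteRamsey.

(** * Generated creatures *)

Section Creatures.
Variable R : realType.
Local Notation C := (creature2 R).
Local Notation K := {fmap nat -> nat}.
Implicit Types (t s : nat -> C) (c : C) (A B : {fset K}).

Definition blocked t := forall n, K2 (t n) /\ (mup (t n) <= mdn (t n.+1))%N.

Definition large t := forall N, exists2 n, (N <= n)%N & (N <= #|` vals (t n)|)%N.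

Definition good t := blocked t /\ large t.

(* The members of [Sigma2] of finite subsequences of [t]: [i] and [j] are the
   least and greatest index used, [l] is the index l^* of the definition. *)
Definition gen t : set C := [set c | K2 c /\ exists i l j,
  [/\ (i <= l <= j)%N, mdn c = mdn (t i), mup c = mup (t j), dis c = dis (t l) &
      (vals c `<=` vals (t l))%fset]].

Definition lognorm n : R := (ln n%:R / ln 2)%R.

(** Since [K2] prescribes the norm, a generated creature is determined by three indices and its set
    of values; see [genE]. *)
Definition span t i l j A : C :=
  Creature (lognorm #|` A|) A (dis (t l)) (mdn (t i)) (mup (t j)).

Definition tail n t := fun m => t (n + m)%N.

(** * Order of the end points in a blocked sequence *)

Lemma K2_lt c : K2 c -> (mdn c < mup c)%N.
Proof. by case=> -[]. Qed.

Lemma blocked_mup t i j : blocked t -> (i < j)%N -> (mup (t i) <= mdn (t j))%N.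
Proof.
move=> bt; elim: j => // j IH; rewrite ltnS leq_eqVlt => /orP[/eqP ->|ij].
  exact: (bt j).2.
apply: leq_trans (IH ij) _; apply: leq_trans (ltnW (K2_lt (bt j).1)) (bt j).2.
Qed.

Lemma blocked_mdn t i j : blocked t -> (i <= j)%N -> (mdn (t i) <= mdn (t j))%N.
Proof.
move=> bt; rewrite leq_eqVlt => /orP[/eqP ->//|ij].
by apply: leq_trans (ltnW (K2_lt (bt i).1)) _; exact: blocked_mup.
Qed.

Lemma blocked_mup_le t i j : blocked t -> (i <= j)%N -> (mup (t i) <= mup (t j))%N.
Proof.
move=> bt; rewrite leq_eqVlt => /orP[/eqP ->//|ij].
by apply: leq_trans (blocked_mup bt ij) (ltnW (K2_lt (bt j).1)).
Qed.

Lemma blocked_lt t i j : blocked t -> (mdn (t i) < mup (t j))%N -> (i <= j)%N.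
Proof. by move=> bt h; rewrite leqNgt; apply/negP => /(blocked_mup bt); lia. Qed.

Lemma blocked_le t i j : blocked t -> (mup (t i) <= mdn (t j))%N -> (i < j)%N.
Proof.
move=> bt h; rewrite ltnNge; apply/negP => /(blocked_mdn bt).
by have := K2_lt (bt i).1; lia.
Qed.

Lemma leq_mdn t n : blocked t -> (n <= mdn (t n))%N.
Proof.
move=> bt; elim: n => // n IH; apply: leq_ltn_trans IH _.
exact: leq_trans (K2_lt (bt n).1) (bt n).2.
Qed.

Lemma lognorm_ge0 n : (0 < n)%N -> (0 <= lognorm n)%R.
Proof.
move=> n0; rewrite divr_ge0 ?ln_ge0 //; first by rewrite ler1n.
by rewrite ler1n.
Qed.

Lemma K2_span t i l j A : blocked t -> (i <= l <= j)%N ->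
  A != fset0 -> (A `<=` vals (t l))%fset -> K2 (span t i l j A).
Proof.
move=> bt /andP[il lj] A0 Al; have [[_ _ v0 vP] [d0 dP] [_ vd] _] := (bt l).1.
have le1 := blocked_mdn bt il; have le2 := blocked_mup_le bt lj.
split=> //=.
- split=> //=; first by rewrite lognorm_ge0 // cardfs_gt0.
    by have := K2_lt (bt l).1; lia.
  move=> f /(fsubsetP Al) fl; have [fH fi] := vP f fl; split=> // x /fi /andP[h1 h2] /=.
  by rewrite (leq_trans le1 h1) (leq_trans h2 le2).
- by split=> // x /dP /andP[h1 h2] /=; rewrite (leq_trans le1 h1) (leq_trans h2 le2).
- by split=> // f /(fsubsetP Al) /vd.
Qed.

Lemma gen_span t i l j A : blocked t -> (i <= l <= j)%N ->
  A != fset0 -> (A `<=` vals (t l))%fset -> gen t (span t i l j A).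
Proof. by move=> bt h A0 Al; split; [exact: K2_span|exists i, l, j]. Qed.

Lemma genE t c : gen t c -> exists i l j A,
  [/\ (i <= l <= j)%N, A != fset0, (A `<=` vals (t l))%fset & c = span t i l j A].
Proof.
case=> Kc [i [l [j [h1 h2 h3 h4 h5]]]]; exists i, l, j, (vals c); split => //.
  by case: Kc => -[].
have [_ _ _ nc] := Kc; rewrite /span -h2 -h3 -h4 /lognorm -nc.
by case: (c).
Qed.

Lemma gen_id t n : blocked t -> gen t (t n).
Proof. by move=> bt; split; [exact: (bt n).1|exists n, n, n; rewrite !leqnn; split]. Qed.

(** Index triples compose: the left index comes from [s i], the middle one from [s l], the right one
    from [s j]. *)
Lemma gen_trans t s : blocked t -> blocked s -> (forall n, gen t (s n)) -> gen s `<=` gen t.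
Proof.
move=> bt bs st c [Kc [i [l [j [/andP[il lj] h2 h3 h4 h5]]]]]; split=> //.
have [Ki [i1 [l1 [j1 [a1 a2 a3 a4 a5]]]]] := st i.
have [Kl [i2 [l2 [j2 [b1 b2 b3 b4 b5]]]]] := st l.
have [Kj [i3 [l3 [j3 [c1 c2 c3 c4 c5]]]]] := st j.
exists i1, l2, j3; split; [|congruence|congruence|congruence|exact: fsubset_trans b5].
(* If [i2 < i1], then [s l] would start before [s i]. The bound [l2 <= j3] is symmetric. *)
have ii : (i1 <= l2)%N.
  have [|] := leqP i1 i2; first lia.
  move=> /(blocked_mup bt); have := blocked_mdn bs il.
  have := K2_lt (bt i2).1; lia.
have jj : (l2 <= j3)%N.
  have [|] := leqP j2 j3; first lia.
  move=> /(blocked_mup bt); have := blocked_mup_le bs lj.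
  have := K2_lt (bt j2).1; lia.
by rewrite ii jj.
Qed.

Lemma blocked_tail t n : blocked t -> blocked (tail n t).
Proof. by move=> bt m; rewrite /tail addnS; exact: bt. Qed.

Lemma good_tail t n : good t -> good (tail n t).
Proof.
move=> [bt lt]; split; first exact: blocked_tail.
move=> N; have [m m1 m2] := lt (n + N)%N; exists (m - n)%N; first lia.
by rewrite /tail subnKC; lia.
Qed.

(** Blocks are disjoint, so [mdn c] bounds the least index used by [c]; membership in a tail is a
    condition on the left end only. *)
Lemma gen_tailP t c n : blocked t ->
  gen (tail n t) c <-> gen t c /\ (mdn (t n) <= mdn c)%N.
Proof.
move=> bt; split.
  move=> [Kc [i [l [j [h1 h2 h3 h4 h5]]]]]; split; last first.
    by rewrite h2; apply: blocked_mdn => //; lia.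
  by split=> //; exists (n + i)%N, (n + l)%N, (n + j)%N; split => //; lia.
move=> [[Kc [i [l [j [h1 h2 h3 h4 h5]]]]] nc]; split=> //.
have ni : (n <= i)%N.
  by apply: (blocked_lt bt); have := K2_lt (bt i).1; lia.
exists (i - n)%N, (l - n)%N, (j - n)%N; rewrite /tail !subnKC; try lia.
by split=> //; lia.
Qed.

(** [Sigma2] sees only the two ends of [u n] and one index between them, and the separation of
    successive sets [u n] can be recovered from [s] being blocked. *)
Lemma pc_leP s t : blocked s -> blocked t -> PC2_le s t <-> forall n, gen t (s n).
Proof.
move=> bs bt; split.
  move=> [u [u0 _ uS]] n; have := uS n; rewrite /restr_set.
  have : sort leq (u n) != [::].
    rewrite -size_eq0 size_sort size_eq0.
    apply: contra (u0 n) => /eqP h; apply/eqP/fsetP => x; rewrite inE.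
    by rewrite -[_ \in u n]/(x \in enum_fset (u n)) h.
  have := sort_sorted leq_total (u n); case: (sort leq (u n)) => // x0 xs.
  move=> srt _ [_ Kn hn hp [l [ls dl vl]]]; split=> //.
  exists x0, (nth 0%N (x0 :: xs) l), (last x0 xs); split=> //.
  - have := ls; rewrite /= size_map => ls'.
    apply/andP; split.
      have := sorted_leq_nth leq_trans leqnn 0%N srt; move=> /(_ 0%N l) /=.
      by rewrite !inE; apply => //.
    have := sorted_leq_nth leq_trans leqnn 0%N srt; move=> /(_ l (size xs)) /=.
    rewrite !inE => h; rewrite -nth_last; case: (xs) h ls' => [|y ys] h ls' //=.
      by case: (l) ls'.
    rewrite (set_nth_default 0%N) /=; last by [].
    by apply: (h ls').
  - by rewrite hp /= last_map.
  - by rewrite dl (nth_map 0%N) // -(size_map t).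
  - by move: vl; rewrite (nth_map 0%N) // -(size_map t).
move=> st.
have /choice [f fP] : forall n, exists q : nat * nat * nat,
    [/\ (q.1.1 <= q.1.2 <= q.2)%N, mdn (s n) = mdn (t q.1.1), mup (s n) = mup (t q.2),
      dis (s n) = dis (t q.1.2) & (vals (s n) `<=` vals (t q.1.2))%fset].
  by move=> n; have [_ [i [l [j h]]]] := st n; exists (i, l, j).
(* All indices between the least and the greatest are taken. *)
pose ls n := iota (f n).1.1 ((f n).2 - (f n).1.1).+1.
exists (fun n => [fset x in ls n]%fset); split.
- move=> n; apply/fset0Pn; exists (f n).1.1; rewrite in_fset /ls mem_iota; lia.
- move=> n x y; rewrite !in_fset /ls !mem_iota => h1 h2.
  have [a1 a2 a3 _ _] := fP n; have [b1 b2 b3 _ _] := fP n.+1.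
  suff : ((f n).2 < (f n.+1).1.1)%N by lia.
  by apply: (blocked_le bt); rewrite -a3 -b2; exact: (bs n).2.
- move=> n; have [a1 a2 a3 a4 a5] := fP n.
  have -> : restr_set t [fset x in ls n]%fset = map t (ls n).
    rewrite /restr_set; congr map; apply: (sorted_eq leq_trans anti_leq).
    - exact: sort_sorted leq_total _.
    - exact: iota_sorted.
    - rewrite perm_sort; apply: uniq_perm; [exact: fset_uniq|exact: iota_uniq|].
      by move=> x; rewrite -[LHS]/(x \in [fset x in ls n]%fset) in_fset.
  rewrite /ls; set i := (f n).1.1; set m := ((f n).2 - i)%N.
  have sz : size (map t (iota i m.+1)) = m.+1 by rewrite size_map size_iota.
  have nthq d l : (l < m.+1)%N -> nth d (map t (iota i m.+1)) l = t (i + l)%N.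
    by move=> lm; rewrite (nth_map 0%N) ?size_iota // nth_iota.
  have lastq : last (t i) (behead (map t (iota i m.+1))) = t (i + m)%N.
    by rewrite -[LHS]/(last (t i) (map t (iota i m.+1))) -nth_last sz nthq.
  have dom : Sigma2_dom (map t (iota i m.+1)).
    split=> l d; rewrite sz => lm; first by rewrite nthq //; exact: (bt _).1.
    by rewrite !nthq // ?(ltnW lm) // addnS; exact: (bt _).2.
  have lm : ((f n).1.2 - i < m.+1)%N by rewrite /m /i; lia.
  have il : (i + ((f n).1.2 - i) = (f n).1.2)%N by rewrite /i; lia.
  split; [exact: dom|exact: (bs n).1|exact: a2| |].
    rewrite a3 -[RHS]/(mup (last (t i) (behead (map t (iota i m.+1))))) lastq.
    by congr (mup (t _)); rewrite /m /i; lia.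
  have := nthq (t i) _ lm; rewrite il => nl.
  by exists ((f n).1.2 - i)%N; split; [rewrite sz|rewrite nl|rewrite nl].
Qed.

(** * Norms and numbers of values *)

Lemma lognorm_le (m n : nat) : (0 < m)%N -> (0 < n)%N ->
  (lognorm m <= lognorm n)%R -> (m <= n)%N.
Proof.
move=> m0 n0; rewrite ler_pM2r ?invr_gt0 ?ln_gt0 ?ltr1n //.
by rewrite ler_ln ?posrE ?ltr0n // ler_nat.
Qed.

Lemma good_PC2 t : PC2 t -> good t.
Proof.
move=> [tK tm tn]; split; first by [].
move=> N.
have [M _ MP] : \forall n \near \oo, (lognorm N.+1 <= nor (t n))%R.
  by move: tn => /cvgryPge; apply.
exists (maxn M N); first exact: leq_maxr.
have := MP (maxn M N) (leq_maxl _ _) => /=.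
have [[_ _ v0 _] _ _ ->] := tK (maxn M N).
by move=> /lognorm_le; rewrite cardfs_gt0 => /(_ isT v0) /ltnW.
Qed.

(** The prescribed cardinalities make the norms log_2(l+1), so the limit clause is automatic and
    members of [R2] can be built by pure combinatorics. *)
Lemma R2P t : R2 t <-> blocked t /\ forall l, #|` vals (t l)| = l.+1.
Proof.
split=> [[/good_PC2 [bt _] cl]//|[bt cl]]; split=> //; split.
- by move=> n; exact: (bt n).1.
- by move=> n; exact: (bt n).2.
apply/cvgryPge => M.
near=> n.
have [_ _ _ ->] := (bt n).1; rewrite cl ler_pdivlMr ?ln_gt0 ?ltr1n //.
rewrite -ler_expR lnK ?posrE ?ltr0n //.
apply: (@le_trans _ _ (n%:R)%R); last by rewrite ler_nat.
near: n; exact: nbhs_infty_ger.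
Unshelve. all: by end_near. Qed.

Lemma R2_good t : R2 t -> good t.
Proof. by case=> /good_PC2. Qed.

End Creatures.

(** * The pigeonhole principle *)

Section Pigeonhole.
Variable R : realType.
Local Notation C := (creature2 R).
Local Notation K := {fmap nat -> nat}.
Implicit Types (t s : nat -> C) (c : C) (A B : {fset K}).

Definition large_family t p (Z : set (nat * {fset K})) := forall N, exists l B,
  [/\ (N <= l)%N, (B `<=` vals (t l))%fset, (N <= #|` B|)%N &
      forall A, (A `<=` B)%fset -> #|` A| = p -> Z (l, A)].

(** If [M] witnesses that [Y] is not large, the finite Ramsey theorem with target [maxn M N] cannot
    return a set whose [p]-subsets all give pairs in [Y], so it returns one for [Z]. *)
Lemma large_familyU t p Y Z : large_family t p (Y `|` Z) ->
  large_family t p Y \/ large_family t p Z.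
Proof.
move=> YZ; have [|nY] := pselect (large_family t p Y); first by left.
right => N; move: nY => /existsNP[M nM].
have [q qP] := hypergraph_Ramsey K p (maxn M N) (maxn M N).
have [l [B [Nl Bl NB BYZ]]] := YZ (maxn q (maxn M N)).
have qB : (q <= #|` B|)%N by exact: leq_trans (leq_maxl _ _) NB.
move: Nl; rewrite !geq_max => /and3P[_ Ml Nl].
have [[T [TB + TQ]]|[T [TB + TQ]]] := qP B (fun A => Y (l, A)) qB;
    rewrite geq_max => /andP[MT NT].
  by case: nM; exists l, T; split=> //; exact: fsubset_trans Bl.
exists l, T; split=> //; first exact: fsubset_trans Bl.
move=> A AT Ap; have [YA|//] := BYZ A (fsubset_trans AT TB) Ap.
by case: (TQ A AT Ap).
Qed.

(* By the finite Ramsey theorem the non-large families form an ideal. *)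
Lemma large_ultrafilter t p : large t ->
  exists V : set_system (nat * {fset K}),
    UltraFilter V /\ forall Z, V Z -> large_family t p Z.
Proof.
move=> lt.
(* The filter dual to the ideal of non-large families. An ultrafilter extending it contains no
   non-large [Z], since it contains the complement. *)
pose F : set_system (nat * {fset K}) := [set Z | ~ large_family t p (~` Z)].
have FF : ProperFilter F.
  split.
    by move=> /(_ _); apply; rewrite setC0 => N; have [l Nl tl] := lt N; exists l, (vals (t l)).
  split.
  - rewrite /F /= setCT => /(_ p)[l [B [_ _ pB H]]].
    by have [A AB Ap] := exists_fsubset pB; exact: (H A AB Ap).
  - by move=> Y Z FY FZ; rewrite /F /= setCI => /large_familyU[].
  - move=> Y Z YZ FY lZ; apply: FY => N; have [l [B [h1 h2 h3 h4]]] := lZ N.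
    by exists l, B; split=> // A AB Ap YA; apply: (h4 A AB Ap); exact: YZ.
have [V [VU FV]] := ultraFilterLemma FF; exists V; split=> // Z VZ.
have [//|nZ] := pselect (large_family t p Z).
have /FV VZ' : F (~` Z) by rewrite /F /= setCK.
by have := filter_ex (filterI VZ VZ') => -[z []].
Qed.

(** One new creature, given by [s_i], [s_l], [s_j], [s_B], with the memory of the construction:
    [heads] holds the left indices chosen so far, [triples] the data [(i, (l, A))] that still accept
    many right indices. *)
Record stage := Stage { heads : {fset nat};
  triples : {fset nat * (nat * {fset K})};
  s_i : nat; s_l : nat; s_j : nat; s_B : {fset K} }.

(** The new set [s_B y] is combined with all heads, old and new, and the right index [s_j y], chosen
    last, has to suit every triple recorded so far. *)
Definition next p (Q : nat -> nat -> nat -> {fset K} -> Prop) t (x y : stage) :=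
  [/\ s_i y \in heads y, (heads x `<=` heads y)%fset, (triples x `<=` triples y)%fset &
   [/\ (s_j x < s_i y <= s_l y)%N, (s_l y <= s_j y)%N, (s_B y `<=` vals (t (s_l y)))%fset,
       (#|` s_B x| < #|` s_B y|)%N &
       (forall i A, i \in heads y -> (A `<=` s_B y)%fset -> #|` A| = p ->
          (i, (s_l y, A)) \in triples y) /\
       (forall i l A, (i, (l, A)) \in triples y -> Q i l (s_j y) A)]].

(** Invariant: each head is good for [V]-many pairs, each triple for [U]-many right indices. Only
    finitely many of these conditions are present at a stage, so their intersection stays in the
    filter and a witness exists. *)
Lemma next_stages t p (Q : nat -> nat -> nat -> {fset K} -> Prop)
    (U : set_system nat) (V : set_system (nat * {fset K})) :
  ProperFilter U -> (forall n, U [set j | (n < j)%N]) ->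
  Filter V -> (forall Z, V Z -> large_family t p Z) ->
  U [set i | V [set z | U [set j | Q i z.1 j z.2]]] ->
  exists f : nat -> stage, forall n, next p Q t (f n) (f n.+1).
Proof.
move=> FU Un FV VL UQ.
pose G i : set (nat * {fset K}) := [set z | U [set j | Q i z.1 j z.2]].
pose Inv x := (forall i, i \in heads x -> V (G i)) /\
  (forall w, w \in triples x -> G w.1 w.2).
have [||f [_ fP]] := @dep_choice _ Inv (next p Q t) (Stage fset0 fset0 0 0 0 fset0); last first.
- by exists f => n; have [] := fP n.
- move=> [I W i0 l0 j0 B0] [/= VI GW].
  have [i [/= Gi ji]] := filter_ex (filterI UQ (Un j0)).
  pose I' := (i |` I)%fset.
  have VI' x : x \in I' -> V (G x) by rewrite !inE => /orP[/eqP ->//|/VI].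
  (* One set [B] serves all heads at once, to the right of [i] and larger than the previous set. *)
  have /VL /(_ (maxn i #|` B0|.+1)) [l [B]] := filter_bigI FV VI'.
  rewrite !geq_max => -[/andP[il _] Bl /andP[_ BB] BG].
  pose W' := (W `|` [fset (x, (l, A)) |
    x : nat in I', A : {fset K} in [fset A in fpowerset B | #|` A| == p]])%fset.
  have GW' w : w \in W' -> G w.1 w.2.
    rewrite inE => /orP[/GW//|/imfset2P[x /= xI' [A]]].
    rewrite !inE /= fpowersetE => /andP[AB /eqP Ap] ->.
    exact: (BG A AB Ap x xI').
  have UW w : w \in W' -> U [set j | Q w.1 w.2.1 j w.2.2] by move/GW'.
  have [j [jW lj]] := filter_ex (filterI (filter_bigI FU UW) (Un l)).
  exists (Stage I' W' i l j B); first by [].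
  split; rewrite /= ?fsubsetU1 ?fsubsetUl //; first by rewrite !inE eqxx.
  split=> //; [by rewrite ji il|exact: ltnW|split].
    move=> x A xI' AB Ap; rewrite inE; apply/orP; right; apply/imfset2P.
    exists x => //; exists A => //.
    by rewrite !inE /= fpowersetE AB Ap eqxx.
  by move=> x y A /jW.
- by split.
Qed.

Lemma pigeonhole_filter t (Q : C -> Prop) p U V : good t -> (0 < p)%N ->
  ProperFilter U -> (forall n, U [set j | (n < j)%N]) ->
  Filter V -> (forall Z, V Z -> large_family t p Z) ->
  U [set i | V [set z | U [set j | Q (span t i z.1 j z.2)]]] ->
  exists s, [/\ good s, forall n, gen t (s n) &
    forall c, gen s c -> #|` vals c| = p -> Q c].
Proof.
move=> [bt lt] p0 FU Un FV VL.
move=> /(next_stages (Q := fun i l j A => Q (span t i l j A)) FU Un FV VL)[f fP].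
(* [next] fixes indices and values of its second stage only, hence the shift by one. *)
pose s n := span t (s_i (f n.+1)) (s_l (f n.+1)) (s_j (f n.+1)) (s_B (f n.+1)).
have fB n : (n <= #|` s_B (f n)|)%N.
  by elim: n => // n IH; have [_ _ _ [_ _ _ + _]] := fP n; exact: leq_ltn_trans.
have st n : gen t (s n).
  have [_ _ _ [/andP[_ il] lj Bl]] := fP n; move=> BB _.
  apply: gen_span => //; first by rewrite il.
  by rewrite -cardfs_gt0; exact: leq_ltn_trans BB.
have bs : blocked s.
  move=> n; split; first exact: (st n).1.
  rewrite /=; apply: blocked_mup => //.
  by have [_ _ _ [/andP[]]] := fP n.+1.
have heads_le m n : (m <= n)%N -> (heads (f m) `<=` heads (f n))%fset.
  move=> /subnKC <-; elim: (n - m)%N => [|k IH]; rewrite ?addn0 // addnS.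
  by apply: fsubset_trans IH _; have [] := fP (m + k)%N.
have triples_le m n : (m <= n)%N -> (triples (f m) `<=` triples (f n))%fset.
  move=> /subnKC <-; elim: (n - m)%N => [|k IH]; rewrite ?addn0 // addnS.
  by apply: fsubset_trans IH _; have [] := fP (m + k)%N.
exists s; split=> //.
  by split=> // N; exists N => //=; exact: leq_trans (fB N.+1).
move=> c /genE[i [l [j [A [/andP[il lj] A0 Al ->]]]]] /= Ap.
(* A span over [s] is a span over [t]. Its triple was recorded at stage [l.+1], when [s_i (f i.+1)]
   was already a head, and is tested at stage [j.+1]. *)
have -> : span s i l j A = span t (s_i (f i.+1)) (s_l (f l.+1)) (s_j (f j.+1)) A by [].
have [_ _ _ [_ _ _ _ [_ hj]]] := fP j; apply: hj.
apply: (fsubsetP (triples_le l.+1 j.+1 lj)).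
have [_ _ _ [_ _ _ _ [hl _]]] := fP l; apply: hl => //.
apply: (fsubsetP (heads_le i.+1 l.+1 il)).
by have [] := fP i.
Qed.

(** An ultrafilter contains each set or its complement, so negation passes through the three nested
    quantifiers along [U], [V], [U]: the iterated limit holds for [Q] or for its negation. *)
Lemma pigeonhole t (Q : C -> Prop) p : good t -> (0 < p)%N ->
  exists s, [/\ good s, forall n, gen t (s n) &
    (forall c, gen s c -> #|` vals c| = p -> Q c) \/
    (forall c, gen s c -> #|` vals c| = p -> ~ Q c)].
Proof.
move=> gt p0.
have [U [UU ooU]] := @ultraFilterLemma nat \oo _.
have [V [VU VL]] := large_ultrafilter p gt.2.
have FU : ProperFilter U by exact: ultra_proper.
have FV : Filter V by apply: filter_filter; exact: ultra_proper.
have Un n : U [set j | (n < j)%N] by apply: ooU; exact: nbhs_infty_gt.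
have [UQ|UQ] := in_ultra_setVsetC [set i | V [set z | U [set j | Q (span t i z.1 j z.2)]]] UU.
  by have [s [gs st sQ]] := @pigeonhole_filter t Q p U V gt p0 FU Un FV VL UQ;
    exists s; split=> //; left.
have [|s [gs st sQ]] := @pigeonhole_filter t (fun c => ~ Q c) p U V gt p0 FU Un FV VL.
  apply: filterS UQ => i nV.
  have [|VQ] := in_ultra_setVsetC [set z | U [set j | Q (span t i z.1 j z.2)]] VU.
    by move=> /nV.
  apply: filterS VQ => z nU.
  have [|UQ] := in_ultra_setVsetC [set j | Q (span t i z.1 j z.2)] UU; first by move=> /nU.
  exact: filterS UQ.
by exists s; split=> //; right.
Qed.

End Pigeonhole.

(** * Approximations and fusion *)

HB.instance Definition _ (R : realType) (V : choiceType) (D : Type) :=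
  gen_eqMixin (creature R V D).

Section Approximations.
Variable R : realType.
Local Notation C := (creature2 R).
Local Notation K := {fmap nat -> nat}.
Local Notation S := (ellentuck (@R2 R) (@PC2_le R)).
Implicit Types (t s : nat -> C) (c : C) (a b : seq C) (x y z : S).

(** The right end of a stem. The default 0 puts no restriction on the first creature. *)
Definition fin a := last 0%N [seq mup c | c <- a].

Lemma fin_rcons a c : fin (rcons a c) = mup c.
Proof. by rewrite /fin map_rcons last_rcons. Qed.

(** Extensions of the stem [a0] by creatures from [G]. The cardinality clause is that of [R2], the
    new creature having index [size a]. *)
Inductive over (a0 : seq C) (G : set C) : seq C -> Prop :=
| over_refl : over a0 G a0
| over_rcons a c : over a0 G a -> G c -> (fin a <= mdn c)%N ->
    #|` vals c| = (size a).+1 -> over a0 G (rcons a c).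

Definition approx := over [::] (@K2 R).

Lemma approx_over a0 t a : approx a0 -> over a0 (gen t) a -> approx a.
Proof. by move=> aa0; elim=> // {}a c _ IH [Kc _] ac cs; exact: over_rcons. Qed.

Lemma approx_nth d a k : approx a -> (k < size a)%N ->
  [/\ K2 (nth d a k), #|` vals (nth d a k)| = k.+1 &
    (k.+1 < size a)%N -> (mup (nth d a k) <= mdn (nth d a k.+1))%N].
Proof.
elim=> // {}a c _ IH Kc ac cs; rewrite size_rcons ltnS leq_eqVlt => /orP[/eqP ->|ka].
  by rewrite nth_rcons ltnn eqxx; split=> //; rewrite ltnn.
have [h1 h2 h3] := IH ka; rewrite !nth_rcons ka; split=> // _.
have [/h3//|ak] := ltnP k.+1 (size a).
have ka' : k.+1 = size a by lia.
rewrite ka' eqxx; apply: leq_trans ac.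
rewrite /fin -nth_last size_map -ka' /= (nth_map d) //.
Qed.

Lemma ell_R2 x : R2 (seq_of x).
Proof. by case: x => x /=; rewrite inE. Qed.

Lemma ell_blocked x : blocked (seq_of x).
Proof. by have /R2P[] := ell_R2 x. Qed.

Lemma ell_good x : good (seq_of x).
Proof. exact/R2_good/ell_R2. Qed.

Lemma ell_card x k : #|` vals (seq_of x k)| = k.+1.
Proof. by have /R2P[_] := ell_R2 x. Qed.

Lemma fin_restr t k : blocked t -> (fin (restr k t) <= mdn (t k))%N.
Proof.
move=> bt; case: k => // k; rewrite /restr mkseqS fin_rcons; exact: (bt k).2.
Qed.

Lemma size_restr T k (t : nat -> T) : size (restr k t) = k.
Proof. exact: size_mkseq. Qed.

Lemma restrS T k (t : nat -> T) : restr k.+1 t = rcons (restr k t) (t k).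
Proof. exact: mkseqS. Qed.

Lemma restr_eq T k (s t : nat -> T) n : restr k s = restr k t -> (n < k)%N -> s n = t n.
Proof.
by move=> /(congr1 (fun q => nth (s n) q n)) + nk; rewrite /restr !nth_mkseq.
Qed.

Lemma approx_restr x k : approx (restr k (seq_of x)).
Proof.
elim: k => [|k IH]; first exact: over_refl.
rewrite restrS; apply: over_rcons => //.
- exact: (ell_blocked x k).1.
- exact/fin_restr/ell_blocked.
- by rewrite ell_card size_restr.
Qed.

(** The counterpart of [basic] for an arbitrary sequence [t]: only the terms after the stem must be
    generated by [t], the stem itself need not be. *)
Definition cone a t : set S :=
  [set x | restr (size a) (seq_of x) = a /\
           forall n, (size a <= n)%N -> gen t (seq_of x n)].

(** Comparison beyond [e] only. With [e = fin a] this is all that a cone with stem [a] depends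
    on. *)
Definition le_from e s t := forall c, gen s c -> (e <= mdn c)%N -> gen t c.

Lemma le_from_gen e s t : blocked s -> blocked t -> (forall n, gen t (s n)) -> le_from e s t.
Proof. by move=> bs bt st c gc _; exact: (gen_trans bt bs st). Qed.

Lemma le_gen_trans t s (r : nat -> C) : blocked t -> blocked s ->
  (forall n, gen t (s n)) -> (forall n, gen s (r n)) -> forall n, gen t (r n).
Proof. by move=> bt bs st rs n; exact: (gen_trans bt bs st). Qed.

Lemma cone_mdn a t x n : cone a t x -> (size a <= n)%N -> (fin a <= mdn (seq_of x n))%N.
Proof.
move=> [xa _] an; rewrite -xa; apply: leq_trans (fin_restr _ (ell_blocked x)) _.
exact: (blocked_mdn (ell_blocked x)).
Qed.

Lemma cone_mono a s t : le_from (fin a) s t -> cone a s `<=` cone a t.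
Proof.
move=> st x xs; split; first exact: xs.1.
by move=> n an; apply: st; [exact: xs.2|exact: cone_mdn xs an].
Qed.

Lemma cone_rcons a t x : cone a t x -> cone (rcons a (seq_of x (size a))) t x.
Proof.
move=> [xa xt]; split; first by rewrite size_rcons restrS xa.
by move=> n; rewrite size_rcons => /ltnW; exact: xt.
Qed.

(** A block that is far enough out and has enough values contains a set of exactly [(size a).+1]
    values. *)
Lemma extend_approx a t : approx a -> good t -> exists2 c, gen t c & approx (rcons a c).
Proof.
move=> aa [bt lt].
have [l] := lt (maxn (fin a) (size a).+1).
rewrite !geq_max => /andP[fl _] /andP[_ /exists_fsubset[A Al Aa]].
have A0 : A != fset0 by rewrite -cardfs_gt0 Aa.
have gc : gen t (span t l l l A) by apply: gen_span => //; rewrite leqnn.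
exists (span t l l l A) => //; apply: over_rcons => //; first exact: gc.1.
exact: leq_trans fl (leq_mdn _ bt).
Qed.

(** Iterated one-step extension. This leads from good sequences back to points of the space, and
    also yields density in the pure candidates. *)
Lemma cone_nonempty a t : approx a -> good t -> cone a t !=set0.
Proof.
move=> aa gt.
have [b aab|f [f0 fS]] := @dep_choice _ approx
    (fun b b' => exists2 c, gen t c & b' = rcons b c) a aa.
  by have [c gc ac] := extend_approx aab gt; exists (rcons b c) => //; exists c.
have sf n : size (f n) = (size a + n)%N.
  elim: n => [|n IH]; first by rewrite f0 addn0.
  by have [_ [c _ ->]] := fS n; rewrite size_rcons IH addnS.
pose d := t 0%N.
have fle n m k : (n <= m)%N -> (k < size (f n))%N -> nth d (f m) k = nth d (f n) k.
  move=> /subnKC <- kn; elim: (m - n)%N => [|i IH]; rewrite ?addn0 // addnS.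
  have [_ [c _ ->]] := fS (n + i)%N; rewrite nth_rcons IH.
  by case: ltnP => //; move: kn; rewrite !sf; lia.
(* The stem [f k.+1] has more than [k] entries, so the default [d] is never read. *)
pose g k := nth d (f k.+1) k.
have gE n k : (k < size (f n))%N -> g k = nth d (f n) k.
  move=> kn; rewrite /g -(@fle _ (maxn n k.+1) k (leq_maxr _ _)); last by rewrite sf; lia.
  by rewrite (@fle n) // leq_maxl.
have gR : R2 g.
  apply/R2P.
  have gP k : [/\ K2 (g k), #|` vals (g k)| = k.+1 & (mup (g k) <= mdn (g k.+1))%N].
    have k2 : (k.+1 < size (f k.+2))%N by rewrite sf; lia.
    have := approx_nth d (fS k.+2).1 (ltnW k2).
    by rewrite -!gE // ?(ltnW k2) // => -[h1 h2 h3]; split=> //; exact: h3.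
  by split=> k; have [] := gP k.
exists (exist _ g (mem_set gR)); split => /=.
  apply: (@eq_from_nth _ d); first by rewrite size_restr.
  move=> k; rewrite size_restr => ka; rewrite nth_mkseq // (@gE 0%N) ?f0 //.
move=> n an; have sfn : size (f (n - size a)) = n by rewrite sf; lia.
have [_ [c gc fE]] := fS (n - size a)%N.
rewrite (@gE (n - size a).+1) ?fE ?nth_rcons ?size_rcons ?sfn ?ltnn ?eqxx //.
Qed.

(* A finite superset of the creatures generated by [ts]: the order of the three
   indices is ignored. *)
Definition gens (ts : seq C) : seq C :=
  flatten [seq flatten [seq flatten [seq
    [seq Creature (lognorm R #|` A|) A (dis v) (mdn u) (mup w) |
      A : {fset K} <- enum_fset (fpowerset (vals v))] | w <- ts] | v <- ts] | u <- ts].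

Lemma mem_gens t n i l j A : (i <= l <= j)%N -> (j < n)%N -> (A `<=` vals (t l))%fset ->
  span t i l j A \in gens (mkseq t n).
Proof.
move=> /andP[il lj] jn Al.
have tn k : (k < n)%N -> t k \in mkseq t n.
  by move=> kn; apply/mapP; exists k; rewrite // mem_iota.
apply/flatten_mapP; exists (t i); first by apply: tn; lia.
apply/flatten_mapP; exists (t l); first by apply: tn; lia.
apply/flatten_mapP; exists (t j); first exact: tn.
apply/mapP; exists A => //.
by rewrite -[_ \in _]/(A \in fpowerset _) fpowersetE.
Qed.

Section Fusion.
Variable P : seq C -> (nat -> C) -> Prop.
(** Heredity is required along [le_from (fin a)], so that [P a] survives changes of the sequence
    before the end of the stem. *)
Hypothesis P_hereditary : forall a s t, good s -> good t ->
  le_from (fin a) s t -> P a t -> P a s.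
Hypothesis P_dense : forall a t, approx a -> good t ->
  exists s, [/\ good s, forall n, gen t (s n) & P a s].

(** The stems are treated one after the other; heredity keeps what was achieved. The test [approx a]
    discards lists that are not stems, which the enumeration by [gens] may produce. *)
Lemma dense_seq (L : seq (seq C)) t : good t ->
  exists s, [/\ good s, forall n, gen t (s n) & forall a, a \in L -> approx a -> P a s].
Proof.
elim: L t => [|a L IH] t gt.
  by exists t; split=> // n; exact: gen_id gt.1.
have [s [gs st sP]] := IH t gt.
have [aa|na] := pselect (approx a); last first.
  exists s; split=> // b; rewrite inE => /orP[/eqP -> /na//|]; exact: sP.
have [r [gr rs rP]] := P_dense aa gs.
exists r; split=> //; first exact: le_gen_trans gt.1 gs.1 st rs.
move=> b; rewrite inE => /orP[/eqP -> //|bL ab].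
by apply: P_hereditary (sP b bL ab) => //; exact: le_from_gen gr.1 gs.1 rs.
Qed.

(** A state consists of the stems treated so far, the current sequence and the terms already chosen.
    Each step picks a term with enough values, adds all stems whose last creature uses chosen terms,
    and refines the remaining tail to obtain [P] for them. *)
Lemma fusion a0 t0 : approx a0 -> good t0 ->
  exists s, [/\ good s, forall n, gen t0 (s n) & forall a, over a0 (gen s) a -> P a s].
Proof.
move=> aa0 gt0.
pose Inv (q : seq (seq C) * (nat -> C) * seq C) :=
  good q.1.2 /\ forall a, a \in q.1.1 -> approx a -> P a q.1.2.
pose next (q q' : seq (seq C) * (nat -> C) * seq C) := exists i,
  [/\ (size q.2 <= #|` vals (q.1.2 i)|)%N, q'.2 = rcons q.2 (q.1.2 i),
     q'.1.1 = q.1.1 ++ [seq rcons a c | a <- q.1.1, c <- gens q'.2] &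
     forall n, gen (tail i.+1 q.1.2) (q'.1.2 n)].
have [t1 [gt1 t10 Pt1]] := dense_seq [:: a0] gt0.
have [||f [f0 fP]] := @dep_choice _ Inv next ([:: a0], t1, [::]).
- by split.
- move=> [[L t] sl] [/= gt PL].
  have [i _ ti] := gt.2 (size sl).
  pose L' := L ++ [seq rcons a c | a <- L, c <- gens (rcons sl (t i))].
  have [t' [gt' t't Pt']] := dense_seq L'
    (good_tail i.+1 gt).
  by exists (L', t', rcons sl (t i)) => //; exists i.
pose L n := (f n).1.1; pose t n := (f n).1.2.
have gt n : good (t n) by have [[]] := fP n.
have bt n : blocked (t n) := (gt n).1.
have PL n a : a \in L n -> approx a -> P a (t n) by have [[_ h] _] := fP n; exact: h.
have /choice[i iP] n := (fP n).2.
pose s n := t n (i n).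
have sl n : (f n).2 = mkseq s n.
  elim: n => [|n IH]; first by rewrite f0.
  by rewrite mkseqS -IH; have [] := iP n.
have LS n : L n.+1 = L n ++ [seq rcons a c | a <- L n, c <- gens (mkseq s n.+1)].
  by rewrite -sl; have [] := iP n.
have Lle m n : (m <= n)%N -> {subset L m <= L n}.
  move=> /subnKC <-; elim: (n - m)%N => [|k IH]; rewrite ?addn0 // addnS => a /IH aL.
  by rewrite LS mem_cat aL.
have tS n : gen (t n.+1) `<=` gen (tail (i n).+1 (t n)).
  apply: gen_trans; [exact: blocked_tail|exact: bt|by have [] := iP n].
have tle m n : (m <= n)%N -> gen (t n) `<=` gen (t m).
  move=> /subnKC <-; elim: (n - m)%N => [|k IH]; rewrite ?addn0 // addnS => c /tS.
  by move=> /(gen_tailP _ _ (bt _))[/IH].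
have st m n : (m <= n)%N -> gen (t m) (s n).
  by move=> mn; apply: (tle _ _ mn); exact: gen_id.
have bs : blocked s.
  move=> n; split; first exact: (bt n _).1.
  have /tS /(gen_tailP _ _ (bt n))[_] := st n.+1 n.+1 (leqnn _).
  by apply: leq_trans; exact: (bt n _).2.
have gs : good s.
  split=> // N; exists N => //; have [+ _ _ _] := iP N.
  by rewrite sl size_mkseq.
have past n c : (forall m, (m < n)%N -> (mup (s m) <= mdn c)%N) -> gen s c ->
    (mdn (s n) <= mdn c)%N.
  move=> nc [_ [k [l [j [_ ck _ _ _]]]]]; rewrite ck; apply: blocked_mdn => //.
  rewrite leqNgt; apply/negP => /nc; rewrite ck.
  by have := K2_lt (bs k).1; lia.
(* A stem is listed once the right index [j] of its last creature has been chosen, that is in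
   [L j.+1]; the terms of [s] up to [j] then end no later than the stem. *)
have overL a : over a0 (gen s) a -> exists2 n, a \in L n &
    forall m, (m < n)%N -> (mup (s m) <= fin a)%N.
  elim=> [|{}a c _ [n aL na] gc ac ca]; first by exists 0%N; rewrite /L ?f0 //= inE.
  have nc : (mdn (s n) <= mdn c)%N.
    by apply: past => // m /na h; exact: leq_trans ac.
  have [k [l [j [A [klj A0 Al cE]]]]] := genE gc.
  have nj : (n <= j)%N.
    apply: (@leq_trans k); last by lia.
    apply: (blocked_lt bs); apply: leq_ltn_trans nc _; rewrite cE /=.
    exact: K2_lt (bs k).1.
  exists j.+1; last first.
    by move=> m mj; rewrite fin_rcons cE /=; exact: blocked_mup_le.
  rewrite LS mem_cat; apply/orP; right; apply/allpairsPdep; exists a, c; split=> //.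
    exact: Lle aL.
  by rewrite cE; exact: mem_gens.
exists s; split=> //.
  by apply: (le_gen_trans gt0.1 gt1.1 t10) => n; have := st 0%N n (leq0n _); rewrite /t f0.
move=> a oa; have [n aL na] := overL a oa.
(* Beyond the stem only the terms of [s] from index [n] on matter, and these are generated by
   [t n]. *)
apply: (P_hereditary gs (gt n) _ (PL n a aL (approx_over aa0 oa))) => c gc ac.
have gnc : gen (tail n s) c.
  by apply/gen_tailP => //; split=> //; apply: past => // m /na h; exact: leq_trans ac.
apply: gen_trans gnc => //; first exact: blocked_tail.
by move=> m; apply: st; rewrite leq_addr.
Qed.

End Fusion.
End Approximations.

(** * Ellentuck's theorem *)

Section Ellentuck.
Variable R : realType.
Local Notation C := (creature2 R).
Local Notation S := (ellentuck (@R2 R) (@PC2_le R)).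
Implicit Types (t s : nat -> C) (c : C) (a b : seq C) (x y z : S) (X M : set S).

(** * Comparison of basic sets with cones *)

Lemma ell_leP x y : PC2_le (seq_of x) (seq_of y) <-> forall n, gen (seq_of y) (seq_of x n).
Proof. exact: pc_leP (ell_blocked x) (ell_blocked y). Qed.

Lemma R2_le_refl t : R2 t -> PC2_le t t.
Proof. by move=> /R2P[bt _]; apply/pc_leP => // n; exact: gen_id. Qed.

Lemma R2_le_trans t s (u : nat -> C) :
  R2 t -> R2 s -> R2 u -> PC2_le t s -> PC2_le s u -> PC2_le t u.
Proof.
move=> /R2P[bt _] /R2P[bs _] /R2P[bu _] /pc_leP => /(_ bt bs) ts /pc_leP => /(_ bs bu) su.
by apply/pc_leP => // n; exact: (gen_trans bu bs su).
Qed.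

(** A creature generated by [x] that starts after the stem uses only terms of [x] of index at least
    [size a]. *)
Lemma cone_le_from a t x : cone a t x -> blocked t -> le_from (fin a) (seq_of x) t.
Proof.
move=> [xa xt] bt c gc ac; have bx := ell_blocked x.
have gc' : gen (tail (size a) (seq_of x)) c.
  apply/gen_tailP => //; split=> //; have [_ [i [_ [_ [_ iE _ _ _]]]]] := gc.
  rewrite iE; apply: (blocked_mdn bx); rewrite leqNgt; apply/negP => ia.
  have : (mup (seq_of x i) <= fin a)%N.
    rewrite -xa; case: (size a) ia => // k ik; rewrite restrS fin_rcons.
    exact: (blocked_mup_le bx).
  by rewrite iE in ac; have := K2_lt (bx i).1; lia.
apply: (gen_trans bt (blocked_tail _ bx) _ gc') => m.
by apply: xt; rewrite leq_addr.
Qed.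

Lemma basic_approx a y z : basic a y z -> approx a /\ restr (size a) (seq_of z) = a.
Proof. by move=> [_ [k <-]]; rewrite size_restr; split=> //; exact: approx_restr. Qed.

Lemma basic_cone a t z : cone a t z -> blocked t -> basic a z `<=` cone a t.
Proof.
move=> zt bt w wz; have [_ wa] := basic_approx wz.
split=> // n an; apply: (cone_le_from zt bt); first exact: ((ell_leP _ _).1 wz.1).
rewrite -[in fin _]wa; apply: leq_trans (fin_restr _ (ell_blocked w)) _.
exact: (blocked_mdn (ell_blocked w)).
Qed.

(** The terms in the stem are those of [z]; the later ones are generated by [s], hence by [z]. *)
Lemma cone_basic a y s z : blocked s -> basic a y z ->
  (forall n, gen (seq_of z) (s n)) -> cone a s `<=` basic a y.
Proof.
move=> bs zy sz x [xa xs]; have [_ zk] := basic_approx zy.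
split; last by exists (size a).
apply: (R2_le_trans (ell_R2 x) (ell_R2 z) (ell_R2 y) _ zy.1).
apply/ell_leP => n; have [na|an] := ltnP n (size a).
  rewrite (@restr_eq _ (size a) _ (seq_of z)) ?xa ?zk //.
  by apply: gen_id; exact: ell_blocked.
exact: (gen_trans (ell_blocked z) bs sz (xs n an)).
Qed.

Lemma over_restr a t x m : cone a t x -> over a (gen t) (restr (size a + m) (seq_of x)).
Proof.
move=> [xa xt]; elim: m => [|m IH]; first by rewrite addn0 xa; exact: over_refl.
rewrite addnS restrS; apply: over_rcons => //.
- by apply: xt; rewrite leq_addr.
- exact/fin_restr/ell_blocked.
- by rewrite ell_card size_restr.
Qed.

Lemma cone_restr a t x m : cone a t x -> cone (restr (size a + m) (seq_of x)) t x.
Proof. by move=> [_ xt]; split; rewrite size_restr // => n an; apply: xt; lia. Qed.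

Definition completely_Ramsey X := forall a t, approx a -> good t ->
  exists s, [/\ good s, forall n, gen t (s n) &
    cone a s `<=` X \/ cone a s `&` X = set0].

Definition completely_null X := forall a t, approx a -> good t ->
  exists s, [/\ good s, forall n, gen t (s n) & cone a s `&` X = set0].

(** The cone is taken below a point [z] of the basic set rather than below [y], which keeps it
    inside the basic set. Any point [w] of the cone then works. *)
Lemma completely_RamseyW X : completely_Ramsey X -> Ramsey X.
Proof.
move=> XR a y _ [z zy].
have [aa _] := basic_approx zy.
have [s [gs sz sX]] := XR a _ aa (ell_good z).
have [w ws] := cone_nonempty aa gs.
exists w; first exact: cone_basic gs.1 zy sz _ ws.
have wcone := basic_cone ws gs.1.
case: sX => [sX|sX]; [left|right]; first exact: subset_trans sX.
by apply/seteqP; split=> // v [/wcone vs vX]; rewrite -sX.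
Qed.

Lemma completely_nullW X : completely_null X -> Ramsey_null X.
Proof.
move=> XR a y _ [z zy].
have [aa _] := basic_approx zy.
have [s [gs sz sX]] := XR a _ aa (ell_good z).
have [w ws] := cone_nonempty aa gs.
exists w; first exact: cone_basic gs.1 zy sz _ ws.
by apply/seteqP; split=> // v [/(basic_cone ws gs.1) vs vX]; rewrite -sX.
Qed.

Section CombinatorialForcing.
Variable X : set S.

Definition accepts a t := cone a t `<=` X.

Definition rejects a t :=
  forall s, good s -> (forall n, gen t (s n)) -> ~ accepts a s.

Lemma accepts_mono a s t : le_from (fin a) s t -> accepts a t -> accepts a s.
Proof. by move=> st; apply: subset_trans; exact: cone_mono. Qed.

Lemma rejects_mono a s t : good s -> good t ->
  le_from (fin a) s t -> rejects a t -> rejects a s.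
Proof.
move=> gs gt st rt r gr rs ar.
(* [r] refines [t] only beyond [fin a]. By [leq_mdn], dropping [fin a] terms leaves creatures that
   start there or later. *)
have gr' := good_tail (fin a) gr.
have rr' n : gen r (tail (fin a) r n) by exact: gen_id gr.1.
apply: (rt _ gr').
  move=> n; apply: st; first exact: (gen_trans gs.1 gr.1 rs).
  apply: leq_trans (leq_mdn _ gr.1) _; apply: blocked_mdn gr.1 _; exact: leq_addr.
by apply: accepts_mono ar; exact: le_from_gen gr'.1 gr.1 rr'.
Qed.

(** Fusion first decides every stem. If the pigeonhole principle then made all one-step extensions
    accepted, each point of the cone would lie in [X] through its next creature, and [a] would be
    accepted. *)
Lemma rejects_rcons a t : approx a -> good t ->
  exists s, [/\ good s, forall n, gen t (s n) &
    accepts a s \/ rejects a s /\ forall c, gen s c -> (fin a <= mdn c)%N ->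
      #|` vals c| = (size a).+1 -> rejects (rcons a c) s].
Proof.
move=> aa gt.
have [|b r ab gr|s [gs st sD]] :=
  @fusion R (fun b r => accepts b r \/ rejects b r) _ _ a t aa gt.
- move=> b r q gr gq rq [h|h]; [left; exact: accepts_mono h|right; exact: rejects_mono h].
- have [[q [gq qr qa]]|nr] :=
    pselect (exists q, [/\ good q, forall n, gen r (q n) & accepts b q]).
    by exists q; split=> //; left.
  exists r; split=> //; first by move=> n; exact: gen_id gr.1.
  by right=> q gq qr qa; apply: nr; exists q.
have [sa|sr] := sD a (over_refl _ _); first by exists s; split=> //; left.
have [r [gr rs rQ]] :=
  (* Creatures starting before the end of the stem get the accepting colour by default. *)
  pigeonhole (fun c => (fin a <= mdn c)%N -> accepts (rcons a c) s) gs (ltn0Sn (size a)).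
have le_rs e : le_from e r s by exact: le_from_gen gr.1 gs.1 rs.
exists r; split=> //; first exact: le_gen_trans gt.1 gs.1 st rs.
case: rQ => rQ; [case: (sr r gr rs)|right].
  move=> x xr; have := cone_rcons xr; set c := seq_of x (size a) => xc.
  apply: (rQ c) => //; first exact: xr.2.
  - exact: ell_card.
  - exact: cone_mdn xr _.
  - exact: cone_mono xc.
split; first exact: rejects_mono sr.
move=> c gc ac cs; apply: (rejects_mono gr gs) => //.
have oc : over a (gen s) (rcons a c).
  by apply: over_rcons => //; [exact: over_refl|exact: (gen_trans gs.1 gr.1 rs)].
by have [acc|//] := sD _ oc; case: (rQ c gc cs).
Qed.

(** After fusion, rejection of [a] spreads to all its extensions. A point of [X] in the cone would
    have a basic neighbourhood inside [X], so that some extension of [a] would be accepted. *)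
Lemma open_completely_Ramsey : open X -> completely_Ramsey X.
Proof.
move=> oX a t aa gt.
have [|s [gs st sP]] := @fusion R (fun b r => accepts b r \/ rejects b r /\
    forall c, gen r c -> (fin b <= mdn c)%N -> #|` vals c| = (size b).+1 ->
    rejects (rcons b c) r) _ rejects_rcons a t aa gt.
  move=> b r q gr gq rq [h|[h1 h2]]; [left; exact: accepts_mono h|right].
  split; first exact: rejects_mono h1.
  move=> c gc bc cs; apply: (rejects_mono gr gq); last exact: h2 (rq c gc bc) bc cs.
  move=> d gd; rewrite fin_rcons => cd; apply: rq => //.
  by apply: leq_trans cd; apply: leq_trans bc _; exact/ltnW/(K2_lt gc.1).
exists s; split=> //.
have [sa|sr] := pselect (accepts a s); first by left.
right; apply/seteqP; split=> // x [xs Xx].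
have rej b : over a (gen s) b -> rejects b s.
  elim=> [|{}b c ob IH gc bc cs]; first by have [//|[]] := sP a (over_refl _ _).
  have [ba|[_]] := sP b ob; last exact.
  by case: (IH s gs) => // n; exact: gen_id gs.1.
have [b [y [_ [xy [m xm]] byX]]] := (open_ellentuckE R2_le_refl R2_le_trans X).1 oX x Xx.
(* Long enough to extend both the stem [a] and the stem [b] of length [m]. *)
pose d := restr (size a + m) (seq_of x).
have := rejects_mono (ell_good x) gs (cone_le_from (cone_restr m xs) gs.1)
  (rej d (over_restr m xs)).
case/(_ (seq_of x) (ell_good x)); first by move=> n; apply: gen_id; exact: ell_blocked.
have xx : basic d x x by split; [exact/R2_le_refl/ell_R2|exists (size a + m)%N].
move=> z zd; apply: byX.
have zx : basic d x z.
  apply: cone_basic xx _ _ zd; first exact: ell_blocked.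
  by move=> n; apply: gen_id; exact: ell_blocked.
split; first exact: R2_le_trans (ell_R2 z) (ell_R2 x) (ell_R2 y) zx.1 xy.
exists m; rewrite -xm !(@restr_take _ m (size a + m)) ?leq_addl //.
by have [_] := basic_approx zx; rewrite size_restr => ->.
Qed.

End CombinatorialForcing.

(** * Nowhere dense sets, meager sets and the property of Baire *)

(** The complement of the closure is open, hence decided. A cone missing it would contain a
    non-empty open subset of the closure. *)
Lemma nowhere_dense_completely_null X : nowhere_dense X -> completely_null X.
Proof.
move=> nX a t aa gt.
have oX : open (~` closure X) by apply: closed_openC; exact: closed_closure.
have [s [gs st sX]] := open_completely_Ramsey oX aa gt.
exists s; split=> //; apply/seteqP; split=> // x [xs Xx].
case: sX => sX; first by case: (sX x xs); exact: subset_closure.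
have [z zs] := cone_nonempty aa gs.
suff : (closure X)^° z by rewrite nX.
have zz : basic a z z.
  by split; [exact/R2_le_refl/ell_R2|exists (size a); exact: zs.1].
have oz : open (basic a z).
  apply/(open_ellentuckE R2_le_refl R2_le_trans) => w wz; exists a, z; split=> //.
  by exists (size a), z; rewrite zs.1.
suff : basic a z `<=` (closure X)^° by exact.
rewrite -open_subsetE // => w /(basic_cone zs gs.1) ws; apply: contrapT => nw.
by have : (cone a s `&` ~` closure X) w by []; rewrite sX.
Qed.

(** Fusion makes each cone avoid [F n] for all [n] up to the length of its stem; a point of [F n] is
    then excluded through its initial segment of length [size a + n]. *)
Lemma bigcup_completely_null (F : nat -> set S) :
  (forall n, completely_null (F n)) -> completely_null (\bigcup_n F n).
Proof.
move=> F0 a t aa gt.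
have [|b r ab gr|s [gs st sP]] := @fusion R (fun b r =>
    forall n, (n <= size b)%N -> cone b r `&` F n = set0) _ _ a t aa gt.
- move=> b r q gr gq rq h n nb; apply/seteqP; split=> // x [/(cone_mono rq) xq Fx].
  by rewrite -(h n nb).
- elim: (size b) => [|k [s [gs sr sF]]].
    have [s [gs sr sF]] := F0 0%N b r ab gr; exists s; split=> // n.
    by rewrite leqn0 => /eqP ->.
  have [q [gq qs qF]] := F0 k.+1 b s ab gs; exists q; split=> //.
    exact: le_gen_trans gr.1 gs.1 sr qs.
  move=> n; rewrite leq_eqVlt => /orP[/eqP -> //|nk].
  apply/seteqP; split=> // x [xq Fx]; rewrite -(sF n nk); split=> //.
  by apply: cone_mono xq; exact: le_from_gen gq.1 gs.1 qs.
exists s; split=> //; apply/seteqP; split=> // x [xs [n _ Fx]].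
have := sP _ (over_restr n xs) n; rewrite size_restr leq_addl => /(_ isT) <-.
by split=> //; exact: cone_restr.
Qed.

Lemma meager_completely_null M : meager M -> completely_null M.
Proof.
by move=> [F nF ->]; apply: bigcup_completely_null => n; exact: nowhere_dense_completely_null.
Qed.

(** First avoid the meager part, then decide the open part: off [M] the set coincides with [U]. *)
Lemma Baire_completely_Ramsey X : has_Baire_property X -> completely_Ramsey X.
Proof.
move=> [U [M [oU mM ->]]] a t aa gt.
have [s [gs st sM]] := meager_completely_null mM aa gt.
have [r [gr rs rO]] := open_completely_Ramsey oU aa gs.
exists r; split=> //; first exact: le_gen_trans gt.1 gs.1 st rs.
have rM x : cone a r x -> ~ M x.
  move=> xr Mx; suff : (cone a s `&` M) x by rewrite sM.
  by split=> //; apply: cone_mono xr; exact: le_from_gen gr.1 gs.1 rs.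
case: rO => rO; [left|right].
  by move=> x xr; left; split; [exact: rO|exact: rM].
apply/seteqP; split=> // x [xr [[Ux _]|[Mx _]]]; last exact: (rM x xr Mx).
by rewrite -rO.
Qed.

End Ellentuck.

Theorem theorem19 (R : realType) :
  topological_Ramsey_space (@R2 R) (@PC2_le R) /\
  (forall t : nat -> creature2 R, PC2 t ->
     exists s : nat -> creature2 R, R2 s /\ PC2_le s t).
Proof.
split; first split.
- exact: R2_le_refl.
- exact: R2_le_trans.
- by move=> A /Baire_completely_Ramsey/completely_RamseyW.
- by move=> A /meager_completely_null/completely_nullW.
move=> t /good_PC2 gt.
(* With the empty stem, all terms of [x] are generated by [t]. *)
have [x [_ xt]] := cone_nonempty (over_refl [::] (@K2 R)) gt.
exists (seq_of x); split; first exact: ell_R2.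
apply/pc_leP; [exact: ell_blocked|exact: gt.1|by move=> n; exact: xt].
Qed.
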